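(* Let $\mu_0,\mu_n\in\mathcal M$ $(n\in\mathbb N)$ be absolutely continuous with respect to $\lambda$. If $\lim_{n\to\infty}\|\mu_0-\mu_n\|=0$ and there is a positive constant $c$ with $\mu_n\ge c\mu_0$ for all $n\in\mathbb N$, then $\lim_{n\to\infty}d_p(\mu_n;S_m)=d_p(\mu_0;S_m)$ for all $m\in\mathbb N$ and all $p\in(0,\infty)$.
   Context: $G=\mathbb Z$, and $\Gamma=[0,2\pi)$ (addition modulo $2\pi$, with the topology of the circle) is its dual group, with normalized Lebesgue measure $\lambda$ and characters $e_x(\gamma)=\mathrm e^{\mathrm ix\gamma}$, $x\in\mathbb Z$. $\mathcal M$ is the set of all non-zero finite non-negative (regular) Borel measures on $\Gamma$; $\|\cdot\|$ is the total variation norm, and inequalities between measures are setwise. For $m\in\mathbb N=\{1,2,\dots\}$, $S_m:=\{m,m+1,m+2,\dots\}$, and $\mathcal T(S_m)$ is the complex linear span of $\{e_x:x\in S_m\}$ (finite sums). For $\mu\in\mathcal M$ and $p\in(0,\infty)$, $d_p(\mu;S_m):=\inf\{\int|1-\tau|^p\,d\mu:\tau\in\mathcal T(S_m)\}$. *)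

(* Defs.v *)
From HB Require Import structures.
From mathcomp Require Import all_boot all_order all_algebra.
From mathcomp Require Import all_classical all_reals all_analysis.
From mathcomp Require Export complex.

Set Implicit Arguments.
Unset Strict Implicit.
Unset Printing Implicit Defensive.

Import Order.TTheory GRing.Theory Num.Theory.
Import numFieldNormedType.Exports.

Local Open Scope classical_set_scope.
Local Open Scope ring_scope.

(* The group law (addition modulo 2 pi) is not needed. *)
Record circle (R : realType) :=
  Circle { angle : R ; angleP : 0 <= angle < 2 * pi }.

Section circle_topology.
Context {R : realType}.

HB.instance Definition _ := [isSub for @angle R].
HB.instance Definition _ := [Choice of circle R by <:].

Lemma circle0_subproof : 0 <= (0 : R) < 2 * pi.
Proof. by rewrite lexx mulr_gt0 ?pi_gt0. Qed.

HB.instance Definition _ := isPointed.Build (circle R) (Circle circle0_subproof).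

Definition circle_embed (g : circle R) : R * R := (cos (angle g), sin (angle g)).

(* The topology of the unit circle, not the subspace topology of [0, 2 pi[ :
   angles close to 2 pi are close to 0. *)
HB.instance Definition _ :=
  Topological.copy (circle R) (initial_topology circle_embed).

HB.instance Definition _ :=
  Measurable.copy (circle R) (g_sigma_algebraType (@open (circle R))).

End circle_topology.

Definition circle_display (R : realType) : measure_display :=
  sigma_display (@open (circle R)).

Section circle_lebesgue.
Context {R : realType}.
Local Open Scope ereal_scope.

Lemma angle_inj : injective (@angle R).
Proof. exact: val_inj. Qed.

Lemma range_angle : range (@angle R) = `[0%R, (2 * pi)%R[%classic.
Proof.
apply/seteqP; split => x /=.
  by case=> g _ <-; rewrite in_itv/=; exact: angleP.
by rewrite in_itv/= => x02; exists (Circle x02).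
Qed.

Lemma measurable_image_angle (A : set (circle R)) :
  measurable A -> measurable (@angle R @` A).
Proof.
pose G := [set B : set (circle R) | measurable (@angle R @` B)].
suff : <<s (@open (circle R)) >> `<=` G by apply.
apply: smallest_sub.
  split.
  - by rewrite /G/= image_set0.
  - move=> B; rewrite /G/= => mB.
    have -> : @angle R @` (setT `\` B) = range (@angle R) `\` (@angle R @` B).
      apply/seteqP; split => x /=.
        move=> [g [_ nBg] <-]; split; first by exists g.
        by move=> [h Bh /angle_inj hg]; apply: nBg; rewrite -hg.
      move=> [[g _ <-] nB]; exists g => //; split => // Bg.
      by apply: nB; exists g.
    by rewrite range_angle; exact: measurableD.
  - move=> F mF; rewrite /G/= image_bigcup.
    exact: bigcupT_measurable.
move=> _ [U oU <-]; rewrite /G/=.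
pose f (x : R) : R * R := (cos x, sin x).
have cf : continuous f.
  move=> x; exact: (cvg_pair (@continuous_cos R x) (@continuous_sin R x)).
have -> : @angle R @` (circle_embed @^-1` U) =
    `[0%R, (2 * pi)%R[%classic `&` f @^-1` U.
  rewrite -range_angle; apply/seteqP; split => x /=.
    by move=> [g Ug <-]; split => //; exists g.
  by move=> [[g _ <-] Ug]; exists g.
apply: measurableI; first exact: measurable_itv.
apply: measurable_realfun.open_measurable; by move/continuousP : cf; exact.
Qed.

Definition circle_lebesgue (A : set (circle R)) : \bar R :=
  (2 * pi)^-1%:E * lebesgue_measure (@angle R @` A).

Let norm_ge0 : 0 <= (2 * pi)^-1%:E :> \bar R.
Proof. by rewrite lee_fin invr_ge0 mulr_ge0// pi_ge0. Qed.

Let circle_lebesgue0 : circle_lebesgue set0 = 0.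
Proof. by rewrite /circle_lebesgue image_set0 measure0 mule0. Qed.

Let circle_lebesgue_ge0 A : 0 <= circle_lebesgue A.
Proof. by rewrite mule_ge0. Qed.

Let circle_lebesgue_sigma_additive : semi_sigma_additive circle_lebesgue.
Proof.
move=> F mF tF mUF; rewrite /circle_lebesgue image_bigcup.
under eq_fun do rewrite -ge0_sume_distrr//.
apply: cvgeZl => //.
apply: measure_semi_sigma_additive.
- by move=> i; exact: measurable_image_angle.
- apply/trivIsetP => i j _ _ ij; move/trivIsetP : tF => /(_ i j I I ij) Fij.
  apply/seteqP; split => // x [[g Fg <-] [h Fh /angle_inj hg]].
  by have : (F i `&` F j) g; [split => //; rewrite -hg|rewrite Fij].
- by rewrite -image_bigcup; exact: measurable_image_angle.
Qed.

HB.instance Definition _ := isMeasure.Build _ _ _ circle_lebesgue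
  circle_lebesgue0 circle_lebesgue_ge0 circle_lebesgue_sigma_additive.

Lemma circle_lebesgue_setT : circle_lebesgue setT = 1.
Proof.
rewrite /circle_lebesgue range_angle lebesgue_measure_itv/= lte_fin.
have pi20 : (0 < 2 * pi :> R)%R by rewrite mulr_gt0 ?pi_gt0.
by rewrite pi20 oppr0 adde0 -EFinM mulVf ?gt_eqF.
Qed.

End circle_lebesgue.

Definition circle_char {R : realType} (x : int) (g : circle R) : R[i] :=
  Complex (cos (x%:~R * angle g)) (sin (x%:~R * angle g)).

Definition trig_poly {R : realType} (S : set int) : set (circle R -> R[i]) :=
  [set tau | exists (n : nat) (a : 'I_n -> R[i]) (x : 'I_n -> int),
     (forall i, S (x i)) /\
     tau = (fun g => \sum_(i < n) a i * circle_char (x i) g)].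

Definition ints_from (m : nat) : set int := [set x | m%:Z <= x].

(* The class of non-zero finite non-negative Borel measures; regularity is
   automatic for finite Borel measures on the (compact metrizable) circle. *)
Definition nonzero_measure {R : realType}
    (mu : {finite_measure set (circle R) -> \bar R}) : Prop :=
  mu setT <> 0%E.

(* The modulus normc is the R-valued version of the norm `|_| of R[i]. *)
Definition dist_p {R : realType} (p : R)
    (mu : {finite_measure set (circle R) -> \bar R}) (S : set int) : \bar R :=
  ereal_inf [set (\int[mu]_g (ComplexField.Normc.normc (1 - tau g) `^ p)%:E)%E
            | tau in trig_poly S].

Section total_variation_norm.
Context d (T : measurableType d) (R : realType).
Variable nu : {charge set T -> \bar R}.

Let hahn_pos := cid (Hahn_decomposition nu).
Let hahn_neg := cid (svalP hahn_pos).

(* |nu|(T); it does not depend on the Hahn decomposition chosen. *)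
Definition total_variation_norm : \bar R :=
  charge_variation (svalP hahn_neg) setT.

End total_variation_norm.

Definition measure_diff d (T : measurableType d) (R : realType)
    (mu nu : {finite_measure set T -> \bar R}) : {charge set T -> \bar R} :=
  cadd (charge_of_finite_measure mu) (copp (charge_of_finite_measure nu)).

(* Main.v *)
Require Import Defs.
From mathcomp Require Import all_boot all_order all_algebra.
From mathcomp Require Import all_classical all_reals all_analysis.
From HB Require Import structures.
From mathcomp Require Import measurable_realfun ring lra zify.

Set Implicit Arguments.
Unset Strict Implicit.
Unset Printing Implicit Defensive.

Import Order.TTheory GRing.Theory Num.Theory.
Import numFieldNormedType.Exports.
Import ComplexField.Normc.

Local Open Scope classical_set_scope.
Local Open Scope ring_scope.

(** Write T for the span of the characters of index at least m, and d(mu) for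
    the infimum of the integrals of |1 - tau|^p over tau in T.

    Upper estimate (dist_p_upper).  For a fixed tau the integrand is bounded,
    so its integral is continuous in total variation; the infimum d is
    therefore upper semicontinuous.

    Lower estimate (dist_p_lower).  For every rho < 1, if nu >= c mu0 and nu is
    close enough to mu0, then rho^2 d(mu0) <= d(nu).  A Hahn decomposition of
    nu - rho mu0 gives a set of small mu0-measure outside which
    nu >= rho mu0.  Intersecting it with a carrier of mu0, on which Lebesgue
    measure is controlled by mu0 (carrier_exists), makes the exceptional set A
    small for Lebesgue measure too; on A only nu >= c mu0 is known.  This loss
    is repaired by a multiplier: since 1 + T is closed under products, for tau
    and sigma in T one has (1 - sigma)(1 - tau) = 1 - tau' with tau' in T.  If
    |1 - sigma|^p is at most 1 / rho everywhere and at most c / rho on A, up to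
    a subset of A of tiny mu0-measure, then rho^2 times the integral of
    |1 - tau'|^p against mu0 is at most the integral of |1 - tau|^p against nu
    up to a tiny error (integral_transfer), and the infimum over tau yields the
    estimate.

    The multiplier (multiplier, circle_multiplier).  It should be exp P with P
    in T, Re P <= e everywhere and Re P <= - K + e on A.  Take - K times the
    Fejer mean of the indicator of an open neighbourhood U of A: it lies
    between - K and 0 and is close to - K well inside U.  Its Fourier
    coefficients are bounded by K times the normalized measure of U, so the
    frequencies below m can be dropped at a cost proportional to that measure
    (analytic_bump): this is where the smallness of A for Lebesgue measure
    enters.  What remains is the real part of an element P of T.  Finally exp P
    is replaced by (1 + P / M)^M, which belongs to 1 + T and whose modulus is
    at most exp (Re P + |P|^2 / (2 M)).

    Multiplying by an analytic factor works for all p > 0 at once, whereas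
    weak compactness of near-minimizers would need p > 1. *)

(** * The Fejer kernel *)

Section fejer.
Context {R : realType}.
Implicit Types (N : nat) (s t x : R).

(** Kept as a sum over pairs of frequencies, so that a band of frequencies can
    be removed by restricting the pairs. *)
Definition fejer N s : R :=
  N%:R^-1 * \sum_(j < N) \sum_(l < N) cos ((j%:R - l%:R) * s).

(** N times the kernel is the squared modulus of the sum of the exponentials of
    index less than N: both its sign and its decay follow. *)
Lemma fejerE N s : fejer N s =
  N%:R^-1 * ((\sum_(j < N) cos (j%:R * s)) ^+ 2
             + (\sum_(j < N) sin (j%:R * s)) ^+ 2).
Proof.
congr (_ * _); rewrite !expr2 !big_distrlr/= -big_split/=.
apply: eq_bigr => j _; rewrite -big_split/=; apply: eq_bigr => l _.
by rewrite mulrBl cosB.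
Qed.

Lemma fejer_ge0 N s : 0 <= fejer N s.
Proof. by rewrite fejerE mulr_ge0 ?invr_ge0// addr_ge0 ?sqr_ge0. Qed.

(** Real and imaginary parts of the geometric sum: the sum of the z^j for
    j < N, times 1 - z, is 1 - z^N, where z has argument s. *)
Lemma sum_cos_sin_telescope N s :
  (1 - cos s) * (\sum_(j < N) cos (j%:R * s))
    + sin s * (\sum_(j < N) sin (j%:R * s)) = 1 - cos (N%:R * s) /\
  (1 - cos s) * (\sum_(j < N) sin (j%:R * s))
    - sin s * (\sum_(j < N) cos (j%:R * s)) = - sin (N%:R * s).
Proof.
elim: N => [|N [IHc IHs]].
  by rewrite !big_ord0 !mul0r cos0 sin0 !mulr0 !subrr addr0 oppr0.
have e : N.+1%:R * s = N%:R * s + s by rewrite -natr1; ring.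
rewrite !big_ord_recr/= e cosD sinD; split.
  by rewrite !mulrDr addrACA IHc; ring.
by rewrite !mulrDr opprD addrACA IHs; ring.
Qed.

(** The geometric sum has modulus |1 - z^N| / |1 - z| with |1 - z^N| <= 2 and
    |1 - z|^2 = 2 (1 - cos s). *)
Lemma fejer_le N s : (1 - cos s) * fejer N s <= 2 / N%:R.
Proof.
case: N => [|N]; first by rewrite /fejer big_ord0 mulr0 mulr0 invr0 mulr0.
rewrite fejerE mulrCA mulrC ler_wpM2r ?invr_ge0//.
have [] := sum_cos_sin_telescope N.+1 s.
set C := \sum_(j < N.+1) cos _; set S := \sum_(j < N.+1) sin _ => hC hS.
have h1 := cos2Dsin2 s; have h2 := cos2Dsin2 (N.+1%:R * s).
have h3 := cos_geN1 (N.+1%:R * s).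
have : ((1 - cos s) * C + sin s * S) ^+ 2 + ((1 - cos s) * S - sin s * C) ^+ 2
   = (2 * (1 - cos s)) * (C ^+ 2 + S ^+ 2).
  have -> : 2 * (1 - cos s) = (1 - cos s) ^+ 2 + sin s ^+ 2.
    by rewrite sin2cos2; ring.
  by ring.
rewrite hC hS sqrrN => e.
have : (1 - cos (N.+1%:R * s)) ^+ 2 + sin (N.+1%:R * s) ^+ 2 <= 4 by lra.
by rewrite e; lra.
Qed.

Local Notation mu := (@lebesgue_measure R).

Lemma continuous_cos_shift (k x : R) :
  continuous (fun t : R => cos (k * (x - t))).
Proof.
move=> t; apply: (@continuous_comp _ _ _ (fun t => k * (x - t)) cos).
  by apply: cvgM; [exact: cvg_cst|apply: cvgB; [exact: cvg_cst|exact: cvg_id]].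
exact: continuous_cos.
Qed.

Lemma integrable_continuous (f : R -> R) (D : set R) : continuous f ->
  measurable D -> D `<=` `[0, 2 * pi]%classic -> mu.-integrable D (EFin \o f).
Proof.
move=> cf mD sD.
have : mu.-integrable `[0, 2 * pi] (EFin \o f).
  apply: continuous_compact_integrable; first exact: segment_compact.
  exact: continuous_subspaceT.
by apply: integrableS => //; exact: measurable_itv.
Qed.

Lemma sin_natD2pi (n : nat) x : sin (x + n%:R * (2 * pi)) = sin x.
Proof.
have -> : n%:R * (2 * pi) = (pi *+ 2) *+ n :> R.
  by rewrite -[pi *+ 2]mulr_natl -[RHS]mulr_natl.
exact: (periodicn (@sinD2pi R)).
Qed.

Lemma integral_cos_shift (j l : nat) x : (j != l)%N ->
  \int[mu]_(t in `[0, 2 * pi]) cos ((j%:R - l%:R) * (x - t)) = 0 :> R.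
Proof.
move=> jl; set k : R := j%:R - l%:R.
have k0 : k != 0 by rewrite subr_eq0 eqr_nat.
pose F (t : R) := - k^-1 * sin (k * (x - t)).
have dF (t : R) : is_derive t 1 F (cos (k * (x - t))).
  by rewrite /F; apply: is_derive_eq; rewrite /GRing.scale/=; field.
have cF : continuous F.
  move=> t; apply: differentiable_continuous.
  by apply/derivable1_diffP; case: (dF t).
rewrite /Rintegral (@continuous_FTC2 _ _ F).
- rewrite /= /F subr0 mulrBr.
  have -> : sin (k * x - k * (2 * pi)) = sin (k * x).
    rewrite -[LHS](sin_natD2pi j) -[RHS](sin_natD2pi l).
    by congr sin; rewrite /k; ring.
  by rewrite subrr.
- by rewrite mulr_gt0// pi_gt0.
- exact/continuous_subspaceT/continuous_cos_shift.
- split.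
  + by move=> t _; case: (dF t).
  + exact/cvg_at_right_filter/cF.
  + exact/cvg_at_left_filter/cF.
- by move=> t _; rewrite derive1E; exact: derive_val.
Qed.

Lemma Rintegral_sum_continuous (I : Type) (r : seq I) (P : pred I)
    (f : I -> R -> R) (D : set R) :
  (forall i, continuous (f i)) -> measurable D ->
  D `<=` `[0, 2 * pi]%classic ->
  \int[mu]_(t in D) (\sum_(i <- r | P i) f i t)
  = \sum_(i <- r | P i) \int[mu]_(t in D) f i t.
Proof.
move=> cf mD sD.
have cs (r' : seq I) : continuous (fun t => \sum_(i <- r' | P i) f i t).
  move=> t; apply: cvg_big => //.
    exact: add_continuous.
  by move=> i _; exact: cf.
elim: r => [|i r IH].
  rewrite big_nil; under eq_Rintegral do rewrite big_nil.
  by rewrite Rintegral_cst// mul0r.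
rewrite big_cons -IH; under eq_Rintegral do rewrite big_cons.
case: ifP => // _; rewrite RintegralD//; exact: integrable_continuous.
Qed.

Lemma integral_fejer_sum (N : nat) (x : R) (D : set R) : measurable D ->
  D `<=` `[0, 2 * pi]%classic ->
  \int[mu]_(t in D) fejer N (x - t) = N%:R^-1 * \sum_(j < N) \sum_(l < N)
    \int[mu]_(t in D) cos ((j%:R - l%:R) * (x - t)).
Proof.
move=> mD sD; rewrite /fejer.
have cc (j : 'I_N) : continuous
    (fun t => \sum_(l < N) cos ((j%:R - l%:R) * (x - t)) : R).
  move=> t; apply: cvg_big => //; first exact: add_continuous.
  by move=> i _; exact: continuous_cos_shift.
rewrite RintegralZl//; last first.
  apply: integrable_continuous => // t.
  apply: cvg_big => //; first exact: add_continuous.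
  by move=> i _; exact: cc.
rewrite Rintegral_sum_continuous//; congr (_ * _); apply: eq_bigr => j _.
by rewrite Rintegral_sum_continuous// => l; exact: continuous_cos_shift.
Qed.

(** Only the N diagonal pairs contribute, by orthogonality. *)
Lemma integral_fejer N x : (0 < N)%N ->
  \int[mu]_(t in `[0, 2 * pi]) fejer N (x - t) = 2 * pi :> R.
Proof.
move=> N0; rewrite integral_fejer_sum//.
have pi20 : 0 < 2 * pi :> R by rewrite mulr_gt0// pi_gt0.
have diag (j l : 'I_N) :
    \int[mu]_(t in `[0, 2 * pi]) cos ((j%:R - l%:R) * (x - t))
    = if l == j then 2 * pi else 0 :> R.
  case: (eqVneq l j) => [->|lj]; last by rewrite integral_cos_shift// eq_sym.
  under eq_Rintegral do rewrite subrr mul0r cos0.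
  rewrite Rintegral_cst//= lebesgue_measure_itv/= lte_fin pi20/=.
  by rewrite subr0 mul1r.
under eq_bigr => j _.
  under eq_bigr do rewrite diag.
  rewrite -big_mkcond/= big_pred1_eq.
  over.
rewrite sumr_const card_ord -[(2 * pi) *+ N]mulr_natl mulKf//.
by rewrite pnatr_eq0 -lt0n.
Qed.

End fejer.

(** * Trigonometric polynomials *)
Section trig_poly_theory.
Context {R : realType}.
Implicit Types (S : set int) (tau sigma : circle R -> R[i]) (g : circle R).

Lemma circle_charD (x y : int) g :
  circle_char (x + y) g = circle_char x g * circle_char y g.
Proof.
rewrite /circle_char rmorphD/= mulrDl cosD sinD.
apply/eqP; rewrite eq_complex/= eqxx/=.
by rewrite addrC [X in X + _]mulrC [X in _ + X]mulrC addrC.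
Qed.

(** Lists of (coefficient, frequency) pairs, unlike families indexed by
    ordinals, can be concatenated. *)
Lemma trig_polyP S tau : trig_poly S tau <->
  exists2 s : seq (R[i] * int), (forall q, q \in s -> S q.2)
    & tau = (fun g => \sum_(q <- s) q.1 * circle_char q.2 g).
Proof.
split=> [[n [a [x [Sx ->]]]]|[s Ss ->]].
  exists [seq (a i, x i) | i <- enum 'I_n].
    by move=> q /mapP[i _ ->]; exact: Sx.
  by apply/funext => g; rewrite big_map big_enum.
exists (size s), (fun i => (tnth (in_tuple s) i).1),
  (fun i => (tnth (in_tuple s) i).2).
split; first by move=> i; apply: Ss; exact: mem_tnth.
by apply/funext => g; rewrite big_tnth.
Qed.

Lemma eq_trig_poly S tau sigma : tau =1 sigma ->
  trig_poly S sigma -> trig_poly S tau.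
Proof. by move=> /funext ->. Qed.

Lemma trig_poly0 S : trig_poly S (fun=> 0 : R[i]).
Proof.
by apply/trig_polyP; exists [::] => //; apply/funext => g; rewrite big_nil.
Qed.

Lemma trig_polyD S tau sigma : trig_poly S tau -> trig_poly S sigma ->
  trig_poly S (fun g => tau g + sigma g).
Proof.
move=> /trig_polyP[s Ss ->] /trig_polyP[t St ->]; apply/trig_polyP.
exists (s ++ t); first by move=> q; rewrite mem_cat => /orP[/Ss|/St].
by apply/funext => g; rewrite big_cat.
Qed.

Lemma trig_poly_monomial S (a : R[i]) (x : int) : S x ->
  trig_poly S (fun g => a * circle_char x g).
Proof.
move=> Sx; apply/trig_polyP; exists [:: (a, x)].
  by move=> q; rewrite inE => /eqP ->.
by apply/funext => g; rewrite big_seq1.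
Qed.

Lemma trig_poly_sum S (I : eqType) (r : seq I) (P : pred I)
    (f : I -> circle R -> R[i]) :
  (forall i, i \in r -> P i -> trig_poly S (f i)) ->
  trig_poly S (fun g => \sum_(i <- r | P i) f i g).
Proof.
elim: r => [|i r IH] Sf.
  by apply: eq_trig_poly (trig_poly0 S) => g; rewrite big_nil.
have Sr : trig_poly S (fun g => \sum_(i <- r | P i) f i g).
  by apply: IH => j jr; apply: Sf; rewrite inE jr orbT.
have [Pi|nPi] := boolP (P i).
  apply: (@eq_trig_poly _ _ (fun g => f i g + \sum_(i <- r | P i) f i g)).
    by move=> g; rewrite big_cons Pi.
  by apply: trig_polyD => //; apply: Sf => //; rewrite mem_head.
by apply: eq_trig_poly Sr => g; rewrite big_cons (negbTE nPi).
Qed.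

Lemma trig_polyM S tau sigma : (forall x y, S x -> S y -> S (x + y)) ->
  trig_poly S tau -> trig_poly S sigma -> trig_poly S (fun g => tau g * sigma g).
Proof.
move=> SD /trig_polyP[s Ss ->] /trig_polyP[t St ->].
apply: eq_trig_poly; first by move=> g; rewrite big_distrlr/=; reflexivity.
apply: trig_poly_sum => q /Ss Sq _; apply: trig_poly_sum => q' /St Sq' _.
apply: eq_trig_poly; last first.
  exact: (trig_poly_monomial (q.1 * q'.1) (SD _ _ Sq Sq')).
by move=> g; rewrite mulrACA -circle_charD.
Qed.

Lemma trig_polyZ S tau (a : R[i]) : trig_poly S tau ->
  trig_poly S (fun g => a * tau g).
Proof.
move=> /trig_polyP[s Ss ->].
apply: eq_trig_poly; first by move=> g; rewrite mulr_sumr; reflexivity.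
apply: trig_poly_sum => q /Ss Sq _.
apply: eq_trig_poly; last exact: (trig_poly_monomial (a * q.1) Sq).
by move=> g; rewrite mulrA.
Qed.

Lemma ints_fromD (m : nat) (x y : int) :
  ints_from m x -> ints_from m y -> ints_from m (x + y).
Proof.
rewrite /ints_from/= => mx my; apply: (le_trans mx); rewrite lerDl.
exact: le_trans my.
Qed.

(** The product structure behind the lower estimate: multiplying a competitor
    1 - tau by a factor 1 - sigma gives another competitor. *)
Lemma trig_poly_1BM S tau sigma : (forall x y, S x -> S y -> S (x + y)) ->
  trig_poly S tau -> trig_poly S sigma ->
  exists2 rho, trig_poly S rho &
    forall g, (1 - tau g) * (1 - sigma g) = 1 - rho g.
Proof.
move=> SD Tt Ts; exists (fun g => (tau g + sigma g) + (- 1) * (tau g * sigma g)).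
  apply: trig_polyD; first exact: trig_polyD.
  by apply: trig_polyZ; exact: trig_polyM.
by move=> g; ring.
Qed.

Lemma trig_poly_1BX S M tau : (forall x y, S x -> S y -> S (x + y)) ->
  trig_poly S tau ->
  exists2 rho, trig_poly S rho & forall g, (1 - tau g) ^+ M = 1 - rho g.
Proof.
move=> SD Tt; elim: M => [|M [rho Tr rhoE]].
  by exists (fun=> 0); [exact: trig_poly0|move=> g; rewrite expr0 subr0].
have [rho' Tr' E] := trig_poly_1BM SD Tt Tr.
by exists rho' => // g; rewrite exprS rhoE E.
Qed.

End trig_poly_theory.

(** * Analytic polynomials whose real part is very negative on a given set *)
Section bump.
Context {R : realType}.
Local Notation mu := (@lebesgue_measure R).

(** The natural number (j - l) + (l - j) is the distance of j and l, because
    one of the truncated differences vanishes. *)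
Lemma card_near_diagonal (N m : nat) (j : 'I_N) :
  (#|[pred l : 'I_N | ((j - l) + (l - j) < m)%N]| <= 2 * m)%N.
Proof.
rewrite cardE -(size_map val) -(size_iota (j - m) (2 * m)).
apply: uniq_leq_size; first by rewrite (map_inj_uniq val_inj) enum_uniq.
move=> _ /mapP[l + ->]; rewrite mem_enum inE mem_iota/= => h.
by apply/andP; split; lia.
Qed.

Lemma cos_distn (j l : nat) (x : R) :
  cos ((j%:R - l%:R) * x) = cos (((j - l) + (l - j))%N%:R * x).
Proof.
have [jl|/ltnW lj] := leqP j l.
  have -> : (j - l = 0)%N by lia.
  by rewrite add0n natrB// -[RHS]cosN -mulNr opprB.
have -> : (l - j = 0)%N by lia.
by rewrite addn0 natrB.
Qed.

Lemma cos_far_le (eta x : R) : 0 < eta -> eta <= `|x| -> `|x| <= 2 * pi - eta ->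
  cos x <= cos eta.
Proof.
move=> e0 ex xe; rewrite -[cos x]cos_norm.
have ep : eta <= pi by lra.
have [xp|xp] := leP `|x| pi.
  by rewrite leNgt ltr_cos ?in_itv/= -?leNgt//; apply/andP; split=> //; lra.
have -> : cos `|x| = cos (2 * pi - `|x|).
  by rewrite -[RHS]cosN opprB -[RHS]cosD2pi; congr cos; rewrite mulr_natl subrK.
by rewrite leNgt ltr_cos ?in_itv/= -?leNgt//; try (apply/andP; split); lra.
Qed.

Lemma cos_lt1 (eta : R) : 0 < eta -> eta <= pi -> cos eta < 1.
Proof.
move=> e0 ep; rewrite -[X in _ < X]cos0 ltr_cos// in_itv/=;
  by apply/andP; split => //; lra.
Qed.

Lemma integral_bounds (U : set (measurableTypeR R)) (f : R -> R) (b : R) :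
  measurable U -> U `<=` `[0, 2 * pi]%classic -> continuous f ->
  (forall t, U t -> `|f t| <= b) ->
  `|\int[mu]_(t in U) f t| <= b * fine (mu U).
Proof.
move=> mU sU cf fb.
have If : mu.-integrable U (EFin \o f) by exact: integrable_continuous.
rewrite (le_trans (le_normr_Rintegral _ If))// -Rintegral_cst//.
apply: le_Rintegral => //.
  apply: integrable_continuous => // t.
  by apply: continuous_comp; [exact: cf|exact: norm_continuous].
by apply: integrable_continuous => // t; exact: cvg_cst.
Qed.

(** The value at x of - K times the Fejer mean of the indicator of U, without
    its harmonics of frequency less than m. *)
Definition highpass (N m : nat) (U : set (measurableTypeR R)) (K x : R) :=
  - (K / (2 * pi)) / N%:R * \sum_(j < N) \sum_(l < N | (m <= (j - l) + (l - j))%N)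
    \int[mu]_(t in U) cos ((j%:R - l%:R) * (x - t)).

(** Each of the at most 2 m N omitted pairs contributes an integral over U of a
    cosine, hence at most the measure of U. *)
Lemma highpass_le (N m : nat) (U : set (measurableTypeR R)) (K x : R) :
  (0 < N)%N -> 0 <= K -> measurable U -> U `<=` `[0, 2 * pi]%classic ->
  highpass N m U K x <= - (K / (2 * pi)) * (\int[mu]_(t in U) fejer N (x - t))
    + K / (2 * pi) * (2 * m)%:R * fine (mu U).
Proof.
move=> N0 K0 mU sU; rewrite integral_fejer_sum// /highpass.
set J := fun j l : nat => \int[mu]_(t in U) cos ((j%:R - l%:R) * (x - t)).
have -> : \sum_(j < N) \sum_(l < N) J j l =
    \sum_(j < N) \sum_(l < N | (m <= (j - l) + (l - j))%N) J j l +
    \sum_(j < N) \sum_(l < N | ((j - l) + (l - j) < m)%N) J j l.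
  rewrite -big_split/=; apply: eq_bigr => j _.
  rewrite (bigID (fun l : 'I_N => (m <= (j - l) + (l - j))%N))/=; congr (_ + _).
  by apply: eq_bigl => l; rewrite ltnNge.
set H := \sum_(j < N) _; set L := \sum_(j < N) _.
have pi0 : 0 < pi :> R by exact: pi_gt0.
have U0 : 0 <= fine (mu U) by exact: fine_ge0.
suff LU : L <= N%:R * ((2 * m)%:R * fine (mu U)).
  have k0 : 0 <= K / (2 * pi) by apply: divr_ge0 => //; lra.
  have NL : N%:R^-1 * L <= (2 * m)%:R * fine (mu U).
    by rewrite mulrC ler_pdivrMr ?ltr0n// [leRHS]mulrC.
  have := ler_wpM2l k0 NL; rewrite mulrDr mulrDr !mulNr !mulrA; lra.
rewrite mulr_natl -[X in _ *+ X]card_ord -sumr_const; apply: ler_sum => j _.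
apply: (@le_trans _ _ (\sum_(l < N | ((j - l) + (l - j) < m)%N) fine (mu U))).
  apply: ler_sum => l _; rewrite -[leRHS]mul1r.
  apply: (le_trans (ler_norm _)); apply: integral_bounds => //.
    exact: continuous_cos_shift.
  by move=> t _; exact: cos_max.
rewrite sumr_const -[leLHS]mulr_natl ler_wpM2r// ler_nat.
exact: card_near_diagonal.
Qed.

(** The kernel has total mass 2 pi, and the part of the circle outside U is at
    circular distance at least eta from x, where the kernel is uniformly
    small. *)
Lemma fejer_mass_near (N : nat) (U : set (measurableTypeR R)) (eta x : R) :
  (0 < N)%N -> 0 < eta -> measurable U -> U `<=` `]0, 2 * pi[%classic ->
  ball x eta `<=` U ->
  2 * pi * (1 - 2 / N%:R / (1 - cos eta)) <= \int[mu]_(t in U) fejer N (x - t).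
Proof.
move=> N0 eta0 mU sU bU.
have pi0 : 0 < pi :> R by exact: pi_gt0.
have sUc : U `<=` `[0, 2 * pi]%classic.
  by apply: subset_trans sU _; exact: subset_itv_oo_cc.
(* As U avoids 0 and 2 pi, so does the ball: a point t outside U cannot be
   close to x modulo 2 pi either. *)
have x0 : eta <= x.
  rewrite leNgt; apply/negP => xe.
  suff /bU/sU : ball x eta 0 by rewrite /= in_itv/= ltxx.
  have : 0 <= x.
    have /bU/sU : ball x eta x by exact: ballxx.
    by rewrite /= in_itv/= => /andP[/ltW].
  by move=> x0; rewrite /ball/= subr0 ger0_norm.
have x2 : x <= 2 * pi - eta.
  rewrite leNgt; apply/negP => xe.
  suff /bU/sU : ball x eta (2 * pi) by rewrite /= in_itv/= ltxx andbF.
  have : x <= 2 * pi.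
    have /bU/sU : ball x eta x by exact: ballxx.
    by rewrite /= in_itv/= => /andP[_ /ltW].
  by move=> x2; rewrite /ball/= ler0_norm; lra.
have c0 : 0 < 1 - cos eta by rewrite subr_gt0 cos_lt1//; lra.
have cF : continuous (fun t => fejer N (x - t) : R).
  move=> t; apply: cvgM; first exact: cvg_cst.
  apply: cvg_big => //; first exact: add_continuous.
  move=> i _; apply: cvg_big => //; first exact: add_continuous.
  by move=> l _; exact: continuous_cos_shift.
have mD : measurable (`[0, 2 * pi] : set (measurableTypeR R)).
  exact: measurable_itv.
have mDU : measurable (`[0, 2 * pi] `\` U : set (measurableTypeR R)).
  exact: measurableD.
have := integral_fejer x N0.
rewrite -[X in Rintegral _ X](setDUK sUc) Rintegral_setU//; last 2 first.
- by rewrite setDUK//; apply: integrable_continuous.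
- by apply/disj_setPS => t [? [_ ?]].
set I1 := \int[mu]_(t in U) _; set I2 := \int[mu]_(t in _) _ => e.
suff : I2 <= 2 * pi * (2 / N%:R / (1 - cos eta)) by lra.
have muD : fine (mu (`[0, 2 * pi] `\` U)) <= 2 * pi.
  have le2pi : (mu (`[0%R, (2 * pi)%R] `\` U) <= (2 * pi)%:E)%E.
    have -> : (2 * pi)%:E = mu `[0%R, (2 * pi)%R] :> \bar R.
      by rewrite /= lebesgue_measure_itv/= lte_fin mulr_gt0//= -EFinB subr0.
    apply: le_measure; [exact: mem_set|exact: mem_set|exact: subDsetl].
  rewrite -lee_fin fineK// ge0_fin_numE//.
  exact: le_lt_trans le2pi (ltry _).
have b0 : 0 <= 2 / N%:R / (1 - cos eta) by rewrite !divr_ge0// ltW.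
apply: (@le_trans _ _
  (2 / N%:R / (1 - cos eta) * fine (mu (`[0, 2 * pi] `\` U)))); last first.
  by rewrite [leRHS]mulrC ler_wpM2l.
apply: (le_trans (ler_norm _)); apply: integral_bounds => //.
move=> t [] /=; rewrite in_itv/= => /andP[t0 t2] nUt.
rewrite ger0_norm ?fejer_ge0// ler_pdivlMr//.
apply: (@le_trans _ _ (fejer N (x - t) * (1 - cos (x - t)))); last first.
  by rewrite mulrC; exact: fejer_le.
apply: ler_wpM2l; first exact: fejer_ge0.
rewrite lerD2l lerN2; apply: cos_far_le => //; last by rewrite ler_norml; lra.
by rewrite leNgt; apply/negP => h; apply: nUt; exact: bU.
Qed.

(** Only nonnegative frequencies are needed to produce a real part: the
    harmonic of frequency k is the real part of a multiple of the character of
    index k. *)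
Lemma highpass_trig_poly (N m : nat) (U : set (measurableTypeR R)) (K : R) :
  measurable U -> U `<=` `[0, 2 * pi]%classic ->
  exists2 P, trig_poly (ints_from m) P &
    forall g : circle R, complex.Re (P g) = highpass N m U K (angle g).
Proof.
move=> mU sU; pose d (j l : nat) := ((j - l) + (l - j))%N.
pose C k : R := \int[mu]_(t in U) cos (k%:R * t).
pose S k : R := \int[mu]_(t in U) sin (k%:R * t).
pose a : R := - (K / (2 * pi)) / N%:R.
exists (fun g => \sum_(j < N) \sum_(l < N | (m <= d j l)%N)
  (Complex (a * C (d j l)) (- (a * S (d j l)))) * circle_char (d j l)%:Z g).
  apply: trig_poly_sum => j _ _; apply: trig_poly_sum => l _ ml.
  by apply: trig_poly_monomial.
move=> g; rewrite /highpass -/a.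
have Re0 : complex.Re (0 : R[i]) = 0 by [].
have ReD : {morph @complex.Re R : x y / x + y} by case=> ? ? [].
rewrite (big_morph _ ReD Re0) mulr_sumr; apply: eq_bigr => j _.
rewrite (big_morph _ ReD Re0) mulr_sumr; apply: eq_bigr => l _.
set k := d j l; rewrite -/k.
suff -> : \int[mu]_(t in U) cos ((j%:R - l%:R) * (angle g - t)) =
    cos (k%:R * angle g) * C k + sin (k%:R * angle g) * S k by rewrite /=; ring.
under eq_Rintegral => t _ do rewrite cos_distn mulrBr cosB.
have cl : continuous (fun t : R => k%:R * t).
  by move=> t; apply: cvgM; [exact: cvg_cst|exact: cvg_id].
have cc : continuous (fun t : R => cos (k%:R * t)).
  by move=> t; apply: continuous_comp; [exact: cl|exact: continuous_cos].
have cs : continuous (fun t : R => sin (k%:R * t)).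
  by move=> t; apply: continuous_comp; [exact: cl|exact: continuous_sin].
have ic : mu.-integrable U (EFin \o (fun t : R => cos (k%:R * t))).
  exact: integrable_continuous.
have is' : mu.-integrable U (EFin \o (fun t : R => sin (k%:R * t))).
  exact: integrable_continuous.
rewrite RintegralD//; last 2 first.
- apply: integrable_continuous => // t.
  by apply: cvgM; [exact: cvg_cst|exact: cc].
- apply: integrable_continuous => // t.
  by apply: cvgM; [exact: cvg_cst|exact: cs].
by rewrite !RintegralZl.
Qed.

(** The smallness of U pays for the dropped low frequencies, uniformly in the
    order N of the Fejer kernel; N is then chosen according to eta. *)
Lemma analytic_bump (m : nat) (K e : R) : 0 <= K -> 0 < e ->
  exists2 d : R, 0 < d & forall U : set (measurableTypeR R), measurable U ->
    U `<=` `]0, 2 * pi[%classic -> (mu U < d%:E)%E ->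
    forall eta : R, 0 < eta ->
    exists P, [/\ trig_poly (ints_from m) P,
      (forall g : circle R, complex.Re (P g) <= e) &
      (forall g : circle R, ball (angle g) eta `<=` U -> complex.Re (P g) <= - K + e)].
Proof.
move=> K0 e0; have pi0 : 0 < pi :> R by exact: pi_gt0.
have k0 : 0 <= K / (2 * pi) by apply: divr_ge0 => //; lra.
pose b := K / (2 * pi) * (2 * m)%:R.
have b0 : 0 <= b by rewrite mulr_ge0.
exists (e / 2 / (b + 1)); first by rewrite divr_gt0//; lra.
move=> U mU sU Ud eta eta0.
have sUc : U `<=` `[0, 2 * pi]%classic.
  by apply: subset_trans sU _; exact: subset_itv_oo_cc.
(* The radius is capped to stay below pi, so that cos h < 1. *)
pose h := Num.min eta 1.
have h0 : 0 < h by rewrite lt_min eta0/=.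
have c0 : 0 < 1 - cos h.
  by rewrite subr_gt0 cos_lt1// ge_min; apply/orP; right; have := pi_ge2 R; lra.
pose N := (Num.truncn (4 * K / e / (1 - cos h))).+1.
have bU : b * fine (mu U) <= e / 2.
  have : fine (mu U) < e / 2 / (b + 1).
    rewrite -lte_fin fineK// ge0_fin_numE//; exact: lt_trans Ud (ltry _).
  rewrite ltr_pdivlMr; last lra.
  have : 0 <= fine (mu U) by exact: fine_ge0.
  nra.
have N0 : (0 < N)%N by [].
have ub x : highpass N m U K x <= e.
  have := highpass_le m x N0 K0 mU sUc; rewrite -/b.
  have : 0 <= \int[mu]_(t in U) fejer N (x - t).
    by apply: Rintegral_ge0 => t _; exact: fejer_ge0.
  move=> /(mulr_ge0 k0); set I := Rintegral _ _ _; lra.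
have lb x : ball x h `<=` U -> highpass N m U K x <= - K + e.
  move=> xU; have := highpass_le m x N0 K0 mU sUc; rewrite -/b.
  have := ler_wpM2l k0 (fejer_mass_near N0 h0 mU sU xU).
  have cancel (q r : R) : q != 0 -> K / (2 * q) * (2 * q * (1 - r)) = K - K * r.
    by move=> q0; field.
  rewrite cancel ?gt_eqF//.
  set I := Rintegral _ _ _.
  suff : K * (2 / N%:R / (1 - cos h)) <= e / 2 by lra.
  have NK : 4 * K / e / (1 - cos h) < N%:R by rewrite truncnS_gt.
  rewrite !mulrA ler_pdivrMr// ler_pdivrMr ?ltr0n//.
  move: NK; rewrite ltr_pdivrMr// ltr_pdivrMr//; lra.
have [P PT PE] := highpass_trig_poly N m K mU sUc.
exists P; split => // g; rewrite PE//.
move=> gU; apply: lb; apply: subset_trans gU.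
by apply: le_ball; rewrite ge_min lexx.
Qed.

End bump.

(** * Multipliers of prescribed size *)
Section multiplier.
Context {R : realType}.

Lemma normc_ge0 (z : R[i]) : 0 <= normc z.
Proof. by case: z => a b /=; exact: sqrtr_ge0. Qed.

Lemma normc_sum (I : Type) (r : seq I) (P : pred I) (f : I -> R[i]) :
  normc (\sum_(i <- r | P i) f i) <= \sum_(i <- r | P i) normc (f i).
Proof.
elim/big_ind2 : _ => //; first by rewrite normc0.
by move=> x x' y y' xx' yy'; apply: (le_trans (le_normcD _ _)); exact: lerD.
Qed.

Lemma normc_circle_char x (g : circle R) : normc (circle_char x g) = 1.
Proof. by rewrite /= cos2Dsin2 sqrtr1. Qed.

Lemma trig_poly_bounded S (tau : circle R -> R[i]) : trig_poly S tau ->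
  exists C : R, forall g, normc (tau g) <= C.
Proof.
move=> /trig_polyP[s _ ->]; exists (\sum_(q <- s) normc q.1) => g.
apply: (le_trans (normc_sum _ _ _)); apply: ler_sum => q _.
by rewrite normcM normc_circle_char mulr1.
Qed.

Lemma normcX (z : R[i]) n : normc (z ^+ n) = normc z ^+ n.
Proof. by elim: n => [|n IH]; rewrite ?expr0 ?normc1// !exprS normcM IH. Qed.

(** |1 + z / M|^2 = 1 + 2 Re z / M + |z|^2 / M^2, and 1 + x <= exp x. *)
Lemma normc_compound_le (z : R[i]) (M : nat) : (0 < M)%N ->
  normc (1 + z * (M%:R^-1)%:C%C) ^+ M
  <= expR (complex.Re z + normc z ^+ 2 / (2 * M%:R)).
Proof.
move=> M0; have M0' : 0 < M%:R :> R by rewrite ltr0n.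
case: z => a b /=; rewrite !mulr0 subr0 !add0r.
rewrite sqr_sqrtr ?addr_ge0 ?sqr_ge0//.
pose u := a / M%:R + (a ^+ 2 + b ^+ 2) / (2 * M%:R ^+ 2).
have -> : a + (a ^+ 2 + b ^+ 2) / (2 * M%:R) = M%:R * u.
  by rewrite /u; field; rewrite gt_eqF.
rewrite expRM_natl; apply: lerXn2r; rewrite ?nnegrE ?sqrtr_ge0 ?expR_ge0//.
rewrite -(@ler_pXn2r _ 2)// ?nnegrE ?sqrtr_ge0 ?expR_ge0//.
rewrite sqr_sqrtr ?addr_ge0 ?sqr_ge0// -expRM_natl.
apply: le_trans (expR_ge1Dx _).
rewrite le_eqVlt; apply/orP; left; apply/eqP.
by rewrite /u; field; rewrite gt_eqF.
Qed.

(** (1 + P / M)^M in place of exp P, for the polynomial P of analytic_bump; M is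
    chosen according to a bound on |P|. *)
Lemma multiplier (m : nat) (K e : R) : 0 <= K -> 0 < e ->
  exists2 d : R, 0 < d & forall U : set (measurableTypeR R), measurable U ->
    U `<=` `]0, 2 * pi[%classic -> (lebesgue_measure U < d%:E)%E ->
    forall eta : R, 0 < eta ->
    exists sigma, [/\ trig_poly (ints_from m) sigma,
      (forall g : circle R, normc (1 - sigma g) <= expR e) &
      (forall g : circle R, ball (angle g) eta `<=` U ->
         normc (1 - sigma g) <= expR (- K + e))].
Proof.
move=> K0 e0; have e20 : 0 < e / 2 by rewrite divr_gt0.
have [d d0 H] := analytic_bump m K0 e20; exists d => // U mU sU Ud eta eta0.
have [P [TP P1 P2]] := H U mU sU Ud eta eta0.
have [C PC] := trig_poly_bounded TP.
pose M := (Num.truncn (C ^+ 2 / e)).+1.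
have M0 : 0 < M%:R :> R by rewrite ltr0n.
have CM g : normc (P g) ^+ 2 / (2 * M%:R) <= e / 2.
  have : C ^+ 2 / e < M%:R by rewrite truncnS_gt.
  have : normc (P g) ^+ 2 <= C ^+ 2.
    apply: lerXn2r => //; rewrite nnegrE ?normc_ge0//.
    exact: le_trans (normc_ge0 _) (PC g).
  rewrite ltr_pdivrMr// ler_pdivrMr ?mulr_gt0//; set v := normc _ ^+ 2; nra.
have [sigma Ts sE] := trig_poly_1BX M (@ints_fromD m)
  (trig_polyZ (- (M%:R^-1)%:C%C) TP).
have sigmaE g : normc (1 - sigma g) <= expR (complex.Re (P g) + e / 2).
  rewrite -sE mulNr opprK [_%:C%C * _]mulrC normcX.
  by apply: (le_trans (normc_compound_le _ _)) => //; rewrite ler_expR lerD2l.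
exists sigma; split => // g.
  by apply: (le_trans (sigmaE g)); rewrite ler_expR; have := P1 g; lra.
move=> gU; apply: (le_trans (sigmaE g)); rewrite ler_expR.
by have := P2 g gU; lra.
Qed.

End multiplier.

(** * Borel functions on the circle *)
Section circle_measurability.
Context {R : realType}.

Lemma open_measurable_circle (A : set (circle R)) : open A -> measurable A.
Proof. by move=> oA; exact: sub_sigma_algebra. Qed.

Lemma continuous_measurable_circle (f : circle R -> R) : continuous f ->
  measurable_fun setT f.
Proof.
move=> /continuousP cf.
apply: (measurability _ (RGenOpens.measurableE R)) => _ [_ [a [b ->]] <-].
by rewrite setTI; apply: open_measurable_circle; apply: cf; exact: interval_open.
Qed.

Lemma continuous_circle_embed : continuous (@circle_embed R).
Proof. exact: initial_continuous. Qed.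

Lemma measurable_cos_angle :
  measurable_fun setT (fun g : circle R => cos (angle g)).
Proof.
apply: continuous_measurable_circle => g.
apply: (@continuous_comp _ _ _ (@circle_embed R) fst).
  exact: continuous_circle_embed.
exact: cvg_fst.
Qed.

Lemma measurable_sin_angle :
  measurable_fun setT (fun g : circle R => sin (angle g)).
Proof.
apply: continuous_measurable_circle => g.
apply: (@continuous_comp _ _ _ (@circle_embed R) snd).
  exact: continuous_circle_embed.
exact: cvg_snd.
Qed.

(** The angle is not continuous on the circle, but it is a Borel function of
    the continuous functions cos and sin of it. *)
Lemma angleE (g : circle R) : angle g =
  if 0 <= sin (angle g) then acos (cos (angle g))
  else 2 * pi - acos (cos (angle g)).
Proof.
have /andP[g0 g2] := angleP g; set x := angle g in g0 g2 *.
have pi0 : 0 < pi :> R by exact: pi_gt0.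
have [xp|xp] := leP x pi.
  by rewrite sin_ge0_pi ?g0//= cosK// in_itv/= g0.
have -> : sin x = - sin (2 * pi - x).
  rewrite -[RHS]sinN opprB -[RHS]sinD2pi; congr sin; by rewrite mulr_natl subrK.
have -> : cos x = cos (2 * pi - x).
  by rewrite -[RHS]cosN opprB -[RHS]cosD2pi; congr cos; rewrite mulr_natl subrK.
have s0 : 0 < sin (2 * pi - x) by apply: sin_gt0_pi; apply/andP; split; lra.
rewrite oppr_ge0 leNgt s0/= cosK; last by rewrite in_itv/=; apply/andP; split; lra.
by lra.
Qed.

Lemma measurable_angle : measurable_fun setT (@angle R).
Proof.
have macos : measurable_fun setT (fun g : circle R => acos (cos (angle g))).
  apply: (measurability _ (RGenOInfty.measurableE R)) => _ [_ [x ->] <-].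
  rewrite setTI.
  have c01 (g : circle R) : -1 <= cos (angle g) <= 1 by rewrite cos_geN1 cos_le1.
  have [x0|x0] := ltP x 0.
    rewrite (_ : _ @^-1` _ = setT)//; apply/seteqP; split => // g _ /=.
    by rewrite in_itv/= andbT (lt_le_trans x0)// acos_ge0.
  have [xp|xp] := ltP pi x.
    rewrite (_ : _ @^-1` _ = set0)//; apply/seteqP; split => // g /=.
    by rewrite in_itv/= andbT ltNge (le_trans (acos_lepi (c01 g)))// ltW.
  rewrite (_ : _ @^-1` _ =
      (fun g : circle R => cos (angle g)) @^-1` `]-oo, cos x[%classic).
    by rewrite -[X in measurable X]setTI; apply: measurable_cos_angle.
  apply/seteqP; split => g /=; rewrite !in_itv/= andbT
      -[in cos (angle g) < _](@acosK R (cos (angle g))) ?in_itv//=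
      ltr_cos// in_itv/= ?x0//.
    by rewrite acos_ge0// acos_lepi.
  by rewrite acos_ge0// acos_lepi.
rewrite (_ : @angle R = fun g => if 0 <= sin (angle g)
    then acos (cos (angle g)) else 2 * pi - acos (cos (angle g))).
  apply: measurable_fun_ifT => //; last exact: measurable_funB.
  by apply: measurable_fun_ler => //; exact: measurable_sin_angle.
by apply/funext => g; rewrite -angleE.
Qed.

Lemma measurable_circle_char (x : int) :
  measurable_fun setT (fun g : circle R => complex.Re (circle_char x g)) /\
  measurable_fun setT (fun g : circle R => complex.Im (circle_char x g)).
Proof.
have cx : continuous (fun t : R => x%:~R * t).
  by move=> t; apply: cvgM; [exact: cvg_cst|exact: cvg_id].
split.
  apply: (measurableT_comp (f := fun t : R => cos (x%:~R * t)) _ measurable_angle).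
  apply: continuous_measurable_fun => t.
  by apply: continuous_comp; [exact: cx|exact: continuous_cos].
apply: (measurableT_comp (f := fun t : R => sin (x%:~R * t)) _ measurable_angle).
apply: continuous_measurable_fun => t.
by apply: continuous_comp; [exact: cx|exact: continuous_sin].
Qed.

Lemma measurable_trig_poly S (tau : circle R -> R[i]) : trig_poly S tau ->
  measurable_fun setT (fun g => complex.Re (tau g)) /\
  measurable_fun setT (fun g => complex.Im (tau g)).
Proof.
move=> /trig_polyP[s _ ->].
have ReD : {morph @complex.Re R : x y / x + y} by case=> ? ? [].
have ImD : {morph @complex.Im R : x y / x + y} by case=> ? ? [].
split.
  under eq_fun do rewrite (big_morph _ ReD erefl).
  apply: measurable_sum => -[[a b] x].
  have [mc ms] := measurable_circle_char x.
  apply: (@eq_measurable_fun _ _ _ _ _ (fun g =>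
    a * complex.Re (circle_char x g) - b * complex.Im (circle_char x g))) => //.
  by apply: measurable_funB; apply: measurable_funM.
under eq_fun do rewrite (big_morph _ ImD erefl).
apply: measurable_sum => -[[a b] x].
have [mc ms] := measurable_circle_char x.
apply: (@eq_measurable_fun _ _ _ _ _ (fun g =>
    a * complex.Im (circle_char x g) + b * complex.Re (circle_char x g))) => //.
by apply: measurable_funD; apply: measurable_funM.
Qed.

Lemma measurable_deviation S (tau : circle R -> R[i]) (p : R) : trig_poly S tau ->
  measurable_fun setT (fun g => normc (1 - tau g) `^ p).
Proof.
move=> /measurable_trig_poly[mr mi].
apply: (measurableT_comp (measurable_powR p)).
rewrite (_ : (fun _ => _) = (fun g =>
    Num.sqrt ((1 - complex.Re (tau g)) ^+ 2 + (- complex.Im (tau g)) ^+ 2))).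
  apply: measurableT_comp.
    by apply: continuous_measurable_fun; exact: sqrt_continuous.
  apply: measurable_funD; apply: measurable_funX; first exact: measurable_funB.
  exact: measurableT_comp.
by apply/funext => g; case: (tau g) => a b /=; rewrite add0r.
Qed.

End circle_measurability.

(** * Comparison of integrals against two measures *)
Section measure_comparison.
Context d (T : measurableType d) (R : realType).
Local Open Scope ereal_scope.

Lemma le_measure_integral_in (mu nu : {measure set T -> \bar R}) (a : R) (D : set T)
    (h : T -> \bar R) : (0 <= a)%R -> measurable D ->
  (forall x, 0 <= h x) -> measurable_fun setT h ->
  (forall A, measurable A -> A `<=` D -> a%:E * mu A <= nu A) ->
  a%:E * \int[mu]_(x in D) h x <= \int[nu]_(x in D) h x.
Proof.
move=> a0 mD h0 mh munu.
pose c : {nonneg R} := NngNum a0.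
have -> : a%:E * \int[mu]_(x in D) h x = \int[mscale c mu]_(x in D) h x.
  by rewrite ge0_integral_mscale//; exact: measurable_funTS.
have restrE (m : {measure set T -> \bar R}) :
    \int[m]_(x in D) h x = \int[mrestr m mD]_(x in D) h x.
  by apply: eq_measure_integral => A mA AD; rewrite /= /mrestr setIidl.
rewrite (restrE nu) (restrE (mscale c mu)).
apply: ge0_le_measure_integral => // A mA.
exact: munu (A `&` D) (measurableI _ _ mA mD) (@subIsetr _ _ _).
Qed.

(** The sum of the two Jordan parts of mu - nu.  Having it as a measure turns
    closeness in total variation into a setwise inequality, which passes to
    integrals. *)
Lemma total_variation_measure (mu nu : {finite_measure set T -> \bar R}) :
  exists V : {measure set T -> \bar R},
    V setT = total_variation_norm (measure_diff mu nu) /\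
    forall A, measurable A -> mu A <= nu A + V A /\ nu A <= mu A + V A.
Proof.
rewrite /total_variation_norm; set H := (X in charge_variation X setT).
exists (charge_variation H); split => // A mA.
have := abse_charge_variation H mA.
have : charge_variation H A \is a fin_num by apply: fin_num_measure.
have := fin_num_measure mu _ mA; have := fin_num_measure nu _ mA.
rewrite /= /measure_diff/= /cadd/= /copp/= /charge_of_finite_measure.
move: (mu A) (nu A) (charge_variation H A) => [a| |] [b| |] [v| |]// _ _ _.
by rewrite -EFinN -EFinD /= -!EFinD !lee_fin ler_norml => /andP[h1 h2]; split; lra.
Qed.

Lemma le_total_variation_norm (mu nu : {finite_measure set T -> \bar R}) (A : set T) :
  measurable A -> mu A <= nu A + total_variation_norm (measure_diff mu nu).
Proof.
move=> mA; have [V [<- VE]] := total_variation_measure mu nu.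
apply: (le_trans (VE A mA).1); rewrite leeD2l//.
by apply: le_measure; rewrite ?inE.
Qed.

Lemma integral_le_total_variation (mu nu : {finite_measure set T -> \bar R})
    (h : T -> R) (C : R) :
  measurable_fun setT h -> (forall x, 0 <= h x <= C)%R ->
  \int[nu]_x (h x)%:E <=
  \int[mu]_x (h x)%:E + C%:E * total_variation_norm (measure_diff mu nu).
Proof.
move=> mh h0C; have [V [<- VE]] := total_variation_measure mu nu.
have mh' : measurable_fun setT (fun x => (h x)%:E) by exact/measurable_EFinP.
have h0 x : 0 <= (h x)%:E by rewrite lee_fin; case/andP: (h0C x).
apply: (@le_trans _ _ (\int[measure_add mu V]_x (h x)%:E)).
  apply: ge0_le_measure_integral => // A mA.
  by rewrite [leRHS]measure_addE; exact: (VE A mA).2.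
rewrite ge0_integral_measure_add// leeD2l//.
rewrite -integral_cst//; apply: ge0_le_integral => //.
by move=> x _; rewrite lee_fin; case/andP: (h0C x).
Qed.

End measure_comparison.

(** * A carrier of an absolutely continuous measure *)
Section carrier.
Context d (T : measurableType d) (R : realType).
Local Open Scope ereal_scope.

Lemma small_tail (mu : {finite_measure set T -> \bar R}) (F : (set T)^nat) (e : R) :
  (forall k, measurable (F k)) -> nonincreasing_seq F -> \bigcap_k F k = set0 ->
  (0 < e)%R -> exists k, mu (F k) < e%:E.
Proof.
move=> mF niF F0 e0.
have : mu \o F @ \oo --> 0%:E.
  rewrite -[X in _ --> X](measure0 mu) -F0; apply: nonincreasing_cvg_mu => //.
    by rewrite ltey_eq fin_num_measure.
  by rewrite F0.
move=> /fine_cvgP[_ /cvgrPdist_lt/(_ e e0)] [k _ /(_ k (leqnn k))] /=.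
rewrite sub0r normrN ger0_norm ?fine_ge0// => h; exists k.
by rewrite -[X in X < _]fineK ?lte_fin// fin_num_measure.
Qed.

(** B is where the density f of mu is positive.  Where f >= 1 / (k + 1), the
    measure la is at most k + 1 times mu; the rest of B has la-measure tending
    to 0 as k grows. *)
Lemma carrier_exists (la mu : {finite_measure set T -> \bar R}) : mu `<< la ->
  exists B, [/\ measurable B,
    (forall E, measurable E -> mu (E `\` B) = 0) &
    forall e : R, (0 < e)%R -> exists2 t : R, (0 < t)%R &
      forall A, measurable A -> mu A < t%:E -> la (A `&` B) < e%:E].
Proof.
move=> mula.
have mula' : charge_of_finite_measure mu `<< la by [].
set f := Radon_Nikodym (charge_of_finite_measure mu) la.
have muE A : measurable A -> mu A = \int[la]_(x in A) f x.
  by move=> mA; rewrite -(Radon_Nikodym_integral mula' mA).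
have intf : la.-integrable setT f by exact: Radon_Nikodym_integrable.
have mf : measurable_fun setT f by exact: measurable_int intf.
pose B := [set x | 0 < f x]; pose Bk (k : nat) := [set x | (k.+1%:R^-1)%:E <= f x].
have mB : measurable B.
  by rewrite -[B]setTI; exact: emeasurable_fun_o_infty.
have mBk k : measurable (Bk k).
  by rewrite -[Bk k]setTI; exact: emeasurable_fun_c_infty.
exists B; split => //.
  move=> E mE; apply/eqP; rewrite eq_le measure_ge0 andbT.
  have mEB : measurable (E `\` B) by exact: measurableD.
  rewrite muE// -(integral0 la (E `\` B)); apply: le_integral => //.
  - exact: integrableS intf.
  - exact: integrable0.
  - by move=> x; rewrite inE => -[_ /negP]; rewrite -leNgt.
move=> e e0; have e20 : (0 < e / 2)%R by rewrite divr_gt0.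
have [k hk] : exists k, la (B `\` Bk k) < (e / 2)%:E.
  apply: small_tail => //.
  - by move=> k; exact: measurableD.
  - move=> a b ab; apply/subsetPset => x [Bx nBx]; split => // xa; apply: nBx.
    by apply: le_trans xa; rewrite lee_fin lef_pV2 ?posrE ?ltr0n// ler_nat ltnS.
  - apply/seteqP; split => // x H; have [Bx _] := H 0%N I.
    have ffin : f x \is a fin_num by exact: Radon_Nikodym_fin_num.
    have fx0 : (0 < fine (f x))%R by rewrite -lte_fin fineK.
    pose k := Num.truncn (fine (f x))^-1.
    have [_] := H k I; apply.
    rewrite /Bk/= -[f x]fineK// lee_fin -[leRHS]invrK lef_pV2 ?posrE ?ltr0n ?invr_gt0//.
    by rewrite ltW// truncnS_gt.
exists (e / 2 / k.+1%:R)%R; first by rewrite divr_gt0// ltr0n.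
move=> A mA At.
have mAB : measurable (A `&` B) by exact: measurableI.
have mABk : measurable (A `&` Bk k) by exact: measurableI.
have mBBk : measurable (B `\` Bk k) by exact: measurableD.
have h1 : (k.+1%:R^-1)%:E * la (A `&` Bk k) <= mu A.
  rewrite -integral_cst//.
  apply: (@le_trans _ _ (mu (A `&` Bk k))); last first.
    by apply: le_measure; rewrite ?inE//; exact: subIsetl.
  rewrite muE//; apply: ge0_le_integral => //.
  - by move=> x _; rewrite lee_fin invr_ge0.
  - exact: measurable_funTS.
  - by move=> x [].
have h2 : la (A `&` Bk k) < (e / 2)%:E.
  have := le_lt_trans h1 At.
  rewrite -[la _]fineK ?fin_num_measure// -EFinM !lte_fin.
  by rewrite mulrC ltr_pM2r// invr_gt0 ltr0n.
apply: (@le_lt_trans _ _ (la ((A `&` Bk k) `|` (B `\` Bk k)))).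
  apply: le_measure; rewrite ?inE//; first exact: measurableU.
  by move=> x [Ax Bx]; have [|] := pselect (Bk k x); [left|right].
apply: (@le_lt_trans _ _ (la (A `&` Bk k) + la (B `\` Bk k))); first exact: measureU2.
by rewrite [e in ltRHS]splitr EFinD lteD.
Qed.

End carrier.

(** * Multipliers adapted to a Borel set *)
Section circle_multiplier.
Context {R : realType}.

Lemma circle_lebesgue_fin : fin_num_fun (@circle_lebesgue R).
Proof.
move=> A mA; rewrite ge0_fin_numE//.
apply: (@le_lt_trans _ _ (circle_lebesgue [set: circle R])); last first.
  by rewrite circle_lebesgue_setT ltry.
by apply: le_measure; rewrite ?inE.
Qed.

HB.instance Definition _ :=
  Measure_isFinite.Build _ _ _ (@circle_lebesgue R) circle_lebesgue_fin.

Lemma lebesgue_image_angle (A : set (circle R)) :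
  lebesgue_measure (@angle R @` A) = ((2 * pi)%:E * circle_lebesgue A)%E.
Proof.
rewrite /circle_lebesgue muleA -EFinM mulfV ?mul1e//.
by rewrite gt_eqF// mulr_gt0// pi_gt0.
Qed.

(** Outer regularity of Lebesgue measure encloses A in a small open set U of
    angles.  G consists of the points of A whose angle is at distance at least
    1 / (k + 1) from the complement of U; they exhaust A as k grows, whence a
    small remainder for mu.  The point of angle 0, where the angle is
    discontinuous, is discarded as a null set. *)
Lemma circle_multiplier (m : nat) (K e : R) : 0 <= K -> 0 < e ->
  exists2 t : R, 0 < t & forall A : set (circle R), measurable A ->
    (circle_lebesgue A < t%:E)%E ->
    forall mu : {finite_measure set (circle R) -> \bar R},
    mu `<< @circle_lebesgue R -> forall z : R, 0 < z ->
    exists sigma, [/\ trig_poly (ints_from m) sigma,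
      forall g : circle R, normc (1 - sigma g) <= expR e &
      exists G, [/\ measurable G, G `<=` A, (mu (A `\` G) < z%:E)%E &
        forall g : circle R, G g -> normc (1 - sigma g) <= expR (- K + e)]].
Proof.
move=> K0 e0; have [t t0 H] := multiplier m K0 e0.
have pi20 : 0 < 2 * pi :> R by rewrite mulr_gt0// pi_gt0.
exists (t / 2 / (2 * pi)); first by rewrite !divr_gt0.
move=> A mA At mu mula z z0.
pose Z0 := @angle R @^-1` [set 0].
have mZ0 : measurable Z0.
  by rewrite -[Z0]setTI; apply: measurable_angle => //; exact: measurable_set1.
pose A' := A `\` Z0.
have mA' : measurable A' by exact: measurableD.
have mI := measurable_image_angle mA'.
have It : (lebesgue_measure (@angle R @` A') < (t / 2)%:E)%E.
  rewrite lebesgue_image_angle.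
  have : (circle_lebesgue A' < (t / 2 / (2 * pi))%:E)%E.
    by apply: le_lt_trans At; apply: le_measure; rewrite ?inE//; exact: subDsetl.
  have := circle_lebesgue_fin mA'; case: (circle_lebesgue A') => [r| |]//= _.
  by rewrite -EFinM !lte_fin ltr_pdivlMr// mulrC.
have [U0 [oU0 AU0 U0t]] := lebesgue_regularity_outer mI
  (lt_trans It (ltry _)) (divr_gt0 t0 (ltr0Sn _ 1)).
pose U := U0 `&` `]0, 2 * pi[%classic.
have oU : open U by apply: openI => //; exact: interval_open.
have AU : @angle R @` A' `<=` U.
  move=> _ [g A'g <-]; split; first by apply: AU0; exists g.
  rewrite /= in_itv/=; have /andP[g0 ->] := angleP g; rewrite andbT lt_neqAle g0 andbT.
  by apply/eqP => g0'; case: A'g => _; apply; rewrite /Z0/= -g0'.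
have mU : measurable (U : set (measurableTypeR R)) by exact: open_measurable.
have Ut : (lebesgue_measure U < t%:E)%E.
  have mU0 : measurable (U0 : set (measurableTypeR R)) by exact: open_measurable.
  apply: (@le_lt_trans _ _
    (lebesgue_measure (@angle R @` A' `|` (U0 `\` @angle R @` A')))).
    apply: le_measure; rewrite ?inE//.
      by apply: measurableU => //; exact: measurableD.
    by move=> x [U0x _]; have [|] := pselect ((@angle R @` A') x); [left|right].
  apply: (@le_lt_trans _ _ (lebesgue_measure (@angle R @` A') +
    lebesgue_measure (U0 `\` @angle R @` A'))%E).
    by apply: measureU2 => //; exact: measurableD.
  by rewrite [t in ltRHS]splitr EFinD lteD.
pose V (k : nat) := [set x : R | ball x k.+1%:R^-1 `<=` U].
have mV k : measurable (V k).
  rewrite (_ : V k = ~` (\bigcup_(y in ~` U) ball y k.+1%:R^-1)).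
    apply: measurableC; apply: open_measurable.
    by apply: bigcup_open => y _; exact: ball_open.
  apply/seteqP; split => x /=.
    by move=> xU [y /= nUy /ball_sym]; move/xU.
  by move=> H0 y xy; apply: contrapT => nUy; apply: H0; exists y => //; exact: ball_sym.
pose G k := A' `&` (@angle R @^-1` V k).
have mG k : measurable (G k).
  apply: measurableI => //; rewrite -[X in measurable X]setTI.
  exact: measurable_angle.
have [k hk] : exists k, (mu (A' `\` G k) < z%:E)%E.
  apply: small_tail => //.
  - by move=> k; exact: measurableD.
  - move=> a b ab; apply/subsetPset => g [A'g nG]; split => // -[_ Ga].
    apply: nG; split => //.
    rewrite /V/=; apply: subset_trans Ga; apply: le_ball.
    by rewrite lef_pV2 ?posrE ?ltr0n// ler_nat ltnS.
  - apply/seteqP; split => // g H0; have [A'g _] := H0 0%N I.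
    have Ug : U (angle g) by apply: AU; exists g.
    have /nbhs_ballP[r /= r0 rU] : nbhs (angle g) U by exact: open_nbhs_nbhs.
    have [_] := H0 (Num.truncn r^-1) I; apply; split => //.
    rewrite /V/=; apply: subset_trans rU; apply: le_ball.
    by rewrite -[leRHS]invrK lef_pV2 ?posrE ?ltr0n ?invr_gt0// ltW// truncnS_gt.
have k0 : 0 < k.+1%:R^-1 :> R by rewrite invr_gt0 ltr0n.
have [sigma [Ts s1 s2]] := H U mU (@subIsetr _ _ _) Ut _ k0.
exists sigma; split => //; exists (G k); split => //; last first.
- by move=> g [_ Vg]; exact: s2.
- apply: le_lt_trans hk.
  have laZ0 : circle_lebesgue Z0 = 0%E.
    rewrite /circle_lebesgue (_ : @angle R @` Z0 = [set 0]).
      by rewrite lebesgue_measure_set1 mule0.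
    apply/seteqP; split => x /=; first by move=> [g + <-].
    by move=> ->; exists (Circle (@circle0_subproof R)).
  have muZ0 : mu Z0 = 0%E by move/null_content_dominatesP : mula; exact.
  apply: (@le_trans _ _ (mu ((A' `\` G k) `|` Z0))).
    apply: le_measure; rewrite ?inE//; first exact: measurableD.
      by apply: measurableU => //; exact: measurableD.
    by move=> g [Ag nG]; have [|] := pselect (Z0 g); [right|left].
  apply: le_trans (measureU2 _ _ _) _ => //; first exact: measurableD.
  by rewrite [X in _ + X]muZ0 adde0.
- by apply: (subset_trans (@subIsetl _ _ _)); exact: subDsetl.
Qed.

End circle_multiplier.

(** * The lower and upper estimates *)
Section transfer.
Context d (T : measurableType d) (R : realType).
Local Open Scope ereal_scope.

(** One factor rho absorbs the excess of f over h, or over c h on G; the other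
    one compares mu with nu outside A. *)
Lemma integral_transfer (mu nu : {finite_measure set T -> \bar R})
    (rho c C : R) (A G : set T) (f h : T -> R) :
  (0 < rho <= 1)%R -> (0 <= c)%R -> measurable A -> measurable G -> G `<=` A ->
  measurable_fun setT f -> measurable_fun setT h ->
  (forall x, 0 <= f x)%R -> (forall x, 0 <= h x <= C)%R ->
  (forall E, measurable E -> E `<=` ~` A -> rho%:E * mu E <= nu E) ->
  (forall E, measurable E -> c%:E * mu E <= nu E) ->
  (forall x, rho * f x <= h x)%R -> (forall x, G x -> rho * f x <= c * h x)%R ->
  (rho ^+ 2)%:E * \int[mu]_x (f x)%:E <= \int[nu]_x (h x)%:E + C%:E * mu (A `\` G).
Proof.
move=> /andP[rho0 rho1] c0 mA mG GA mf mh f0 h0C cmpA cmp fh fGh.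
have h0 x : (0 <= h x)%R by case/andP: (h0C x).
have mf' : measurable_fun setT (EFin \o f) by exact/measurable_EFinP.
have mh' : measurable_fun setT (EFin \o h) by exact/measurable_EFinP.
have mnA : measurable (~` A) by exact: measurableC.
have mAG : measurable (A `\` G) by exact: measurableD.
have split_int (m : {measure set T -> \bar R}) (k : T -> R) : (forall x, 0 <= k x)%R ->
    measurable_fun setT (EFin \o k) ->
    \int[m]_x (k x)%:E = \int[m]_(x in ~` A) (k x)%:E + \int[m]_(x in G) (k x)%:E
      + \int[m]_(x in A `\` G) (k x)%:E.
  move=> k0 mk; have k0' x : 0 <= (k x)%:E by rewrite lee_fin.
  rewrite -addeA -ge0_integral_setU//; last 2 first.
  - exact: measurable_funTS.
  - by apply/disj_setPS => x [? []].
  rewrite setDUK// -ge0_integral_setU//.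
  - by rewrite setvU.
  - exact: measurable_funTS.
  - by apply/disj_setPS => x [].
have intZ (D : set T) : measurable D ->
    rho%:E * \int[mu]_(x in D) (f x)%:E = \int[mu]_(x in D) (rho * f x)%:E.
  move=> mD; under [RHS]eq_integral do rewrite EFinM.
  rewrite ge0_integralZl//.
  - exact: measurable_funTS.
  - by move=> x _; rewrite lee_fin.
  - by rewrite lee_fin ltW.
have rf0 x : (0 <= rho * f x)%R by rewrite mulr_ge0// ltW.
have mrf : measurable_fun setT (fun x => (rho * f x)%:E).
  by apply/measurable_EFinP; exact: measurable_funM.
rewrite expr2 EFinM -muleA intZ// split_int//.
have i0 D (k : T -> R) : (forall x, 0 <= k x)%R -> 0 <= \int[mu]_(x in D) (k x)%:E.
  by move=> k0; apply: integral_ge0 => x _; rewrite lee_fin.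
have rho0E : 0 <= rho%:E :> \bar R by rewrite lee_fin ltW.
have rhoE (x : \bar R) : 0 <= x -> rho%:E * x <= x.
  by move=> x0; rewrite -[leRHS]mul1e lee_wpmul2r// lee_fin.
have s1 : rho%:E * \int[mu]_(x in ~` A) (rho * f x)%:E <= \int[nu]_(x in ~` A) (h x)%:E.
  apply: (@le_trans _ _ (rho%:E * \int[mu]_(x in ~` A) (h x)%:E)).
    have le1 : \int[mu]_(x in ~` A) (rho * f x)%:E <= \int[mu]_(x in ~` A) (h x)%:E.
      apply: ge0_le_integral => //.
      - by move=> x _; rewrite lee_fin.
      - exact: measurable_funTS.
      - exact: measurable_funTS.
      - by move=> x _; rewrite lee_fin.
    exact: lee_wpmul2l.
  by apply: le_measure_integral_in => //; exact: ltW.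
have s2 : rho%:E * \int[mu]_(x in G) (rho * f x)%:E <= \int[nu]_(x in G) (h x)%:E.
  apply: (le_trans (rhoE _ (i0 _ _ rf0))).
  apply: (@le_trans _ _ (c%:E * \int[mu]_(x in G) (h x)%:E)).
    rewrite -ge0_integralZl//; last 2 first.
    - exact: measurable_funTS.
    - by move=> x _; rewrite lee_fin.
    apply: ge0_le_integral => //.
    - by move=> x _; rewrite lee_fin.
    - exact: measurable_funTS.
    - by apply: measurable_funeM; exact: measurable_funTS.
  by apply: le_measure_integral_in => // E mE _; exact: cmp.
have s3 : rho%:E * \int[mu]_(x in A `\` G) (rho * f x)%:E <= C%:E * mu (A `\` G).
  apply: (le_trans (rhoE _ (i0 _ _ rf0))).
  rewrite -integral_cst//; apply: ge0_le_integral => //.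
  - by move=> x _; rewrite lee_fin.
  - exact: measurable_funTS.
  - by move=> x _; rewrite lee_fin (le_trans (fh x))//; case/andP: (h0C x).
have s4 : \int[nu]_(x in ~` A) (h x)%:E + \int[nu]_(x in G) (h x)%:E <=
    \int[nu]_x (h x)%:E.
  rewrite (split_int nu h)// leeDl//.
  by apply: integral_ge0 => x _; rewrite lee_fin.
move: s1 s2 s3 s4 (i0 (~` A) _ rf0) (i0 G _ rf0) (i0 (A `\` G) _ rf0).
set F1 := integral _ _ _; set H1 := integral _ _ _.
set F2 := integral _ _ _; set H2 := integral _ _ _.
set F3 := integral _ _ _; set H3 := integral _ _ _.
move: F1 F2 F3 H1 H2 H3 => F1 F2 F3 H1 H2 H3 s1 s2 s3 s4 F10 F20 F30.
rewrite !ge0_muleDr ?adde_ge0//; apply: leeD => //.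
by apply: le_trans s4; exact: leeD.
Qed.

End transfer.

Section distance.
Context {R : realType}.
Implicit Types mu nu : {finite_measure set (circle R) -> \bar R}.

Lemma deviation_bounded S (tau : circle R -> R[i]) (p : R) : 0 < p ->
  trig_poly S tau -> exists2 C : R, 0 < C &
  forall g, 0 <= normc (1 - tau g) `^ p <= C.
Proof.
move=> p0 /trig_poly_bounded[C tC]; exists ((1 + `|C|) `^ p).
  by rewrite powR_gt0// ltr_pwDl.
move=> g; rewrite powR_ge0/=; apply: ge0_ler_powR.
- exact: ltW.
- by rewrite nnegrE normc_ge0.
- by rewrite nnegrE addr_ge0.
- apply: (le_trans (le_normcD _ _)); rewrite normcN normc1 lerD2l.
  exact: le_trans (tC g) (ler_norm _).
Qed.

Lemma dist_p_ge0 (p : R) mu S : (0 <= dist_p p mu S)%E.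
Proof.
apply: le_ereal_inf_tmp => _ [tau _ <-].
by apply: integral_ge0 => g _; rewrite lee_fin powR_ge0.
Qed.

Lemma dist_p_fin (p : R) mu S : 0 < p -> dist_p p mu S \is a fin_num.
Proof.
move=> p0; rewrite ge0_fin_numE ?dist_p_ge0//.
apply: (@le_lt_trans _ _ (\int[mu]_g (normc (1 - (0 : R[i])) `^ p)%:E)%E).
  by apply: ereal_inf_lbound; exists (fun=> 0) => //; exact: trig_poly0.
rewrite subr0 normc1 powR1 integral_cst// mul1e.
by rewrite ltey_eq fin_num_measure.
Qed.

(** With e = - ln rho / p and - K <= ln c / p, the multiplier has |1 - sigma|^p
    at most 1 / rho everywhere and at most c / rho on G. *)
Lemma dist_p_lower (m : nat) (p c rho : R) mu0 :
  0 < p -> 0 < c -> 0 < rho < 1 -> mu0 `<< @circle_lebesgue R ->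
  exists2 t : R, 0 < t & forall nu : {finite_measure set (circle R) -> \bar R},
    (forall A, measurable A -> c%:E * mu0 A <= nu A)%E ->
    (total_variation_norm (measure_diff mu0 nu) < t%:E)%E ->
    ((rho ^+ 2)%:E * dist_p p mu0 (ints_from m) <= dist_p p nu (ints_from m))%E.
Proof.
move=> p0 c0 /andP[rho0 rho1] mu0la.
pose K := Num.max 0 (- ln c / p); pose e := - ln rho / p.
have K0 : 0 <= K by rewrite le_max lexx.
have e0 : 0 < e by rewrite divr_gt0// oppr_gt0 ln_lt0// rho0.
have eE : expR e `^ p = rho^-1.
  by rewrite -expRM /e mulfVK ?gt_eqF// expRN lnK.
have KE : expR (- K + e) `^ p <= c * rho^-1.
  rewrite -expRM mulrDl expRD.
  have -> : e * p = - ln rho.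
    by rewrite /e mulfVK ?gt_eqF.
  rewrite expRN lnK//; apply: ler_wpM2r; first by rewrite invr_ge0 ltW.
  rewrite -[leRHS](@lnK R c)// ler_expR mulNr lerNl -ler_pdivrMr//.
  by rewrite le_max lexx orbT.
have [t1 t10 H1] := circle_multiplier m K0 e0.
have [B [mB muB HB]] := @carrier_exists _ _ _ (@circle_lebesgue R) mu0 mu0la.
have [t2 t20 H2] := HB _ t10.
exists ((1 - rho) * t2); first by rewrite mulr_gt0// subr_gt0.
move=> nu cmp TV.
have [P [N [[mP posP] [mN negN] PN _]]] := Hahn_decomposition
  (cadd (charge_of_finite_measure nu)
    (cscale (- rho) (charge_of_finite_measure mu0))).
have posP' E : measurable E -> E `<=` P -> (rho%:E * mu0 E <= nu E)%E.
  move=> mE EP; have : (0 <= nu E + (- rho)%:E * mu0 E)%E := posP E mE EP.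
  rewrite -(fineK (fin_num_measure mu0 E mE)) -(fineK (fin_num_measure nu E mE)).
  by rewrite -!EFinM -!EFinD !lee_fin; lra.
(* (1 - rho) mu0 N <= mu0 N - nu N, which is at most the total variation. *)
have Nsmall : (mu0 N < t2%:E)%E.
  have : (nu N + (- rho)%:E * mu0 N <= 0)%E := negN N mN (@subset_refl _ _).
  move: TV (le_total_variation_norm mu0 nu mN).
  rewrite -(fineK (fin_num_measure mu0 N mN)) -(fineK (fin_num_measure nu N mN)).
  move: (fine (mu0 N)) (fine (nu N)) => x y.
  case: (total_variation_norm _) => [v| |];
    [|by rewrite ltNge leey|by rewrite addeNy leeNy_eq].
  by rewrite -!EFinM -!EFinD !lee_fin !lte_fin => TV le1 le2; nra.
pose A := N `&` B.
have mA : measurable A by exact: measurableI.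
have At : (circle_lebesgue A < t1%:E)%E by exact: H2.
have cmpA E : measurable E -> E `<=` ~` A -> (rho%:E * mu0 E <= nu E)%E.
  move=> mE EA.
  have mEB : measurable (E `&` B) by exact: measurableI.
  have -> : mu0 E = mu0 (E `&` B).
    by have := measureDI mu0 mE mB; rewrite [X in _ = X + _]muB// add0e.
  apply: (@le_trans _ _ (nu (E `&` B))).
    apply: posP' => // g [Eg Bg].
    have : (P `|` N) g by rewrite PN.
    by case=> // Ng; exfalso; exact: (EA g Eg).
  by apply: le_measure; rewrite ?inE//; exact: subIsetl.
apply: le_ereal_inf_tmp => _ [tau Ttau <-].
have [C C0 hC] := deviation_bounded p0 Ttau.
apply/lee_addgt0Pr => z z0.
have [sigma [Ts s1 [G [mG GA AGz s2]]]] :=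
  H1 A mA At mu0 mu0la (z / C) (divr_gt0 z0 C0).
have [rh Tr rhE] := trig_poly_1BM (@ints_fromD m) Ts Ttau.
have powE g : normc (1 - rh g) `^ p =
    normc (1 - sigma g) `^ p * normc (1 - tau g) `^ p.
  by rewrite -rhE normcM powRM// normc_ge0.
apply: (@le_trans _ _
  ((rho ^+ 2)%:E * \int[mu0]_g (normc (1 - rh g) `^ p)%:E)%E).
  apply: lee_wpmul2l; first by rewrite lee_fin sqr_ge0.
  by apply: ereal_inf_lbound; exists rh.
apply: (@le_trans _ _
  (\int[nu]_g (normc (1 - tau g) `^ p)%:E + C%:E * mu0 (A `\` G))%E).
  apply: (@integral_transfer _ _ _ mu0 nu rho c C A G) => //.
  - by rewrite rho0 ltW.
  - exact: ltW.
  - exact: measurable_deviation Tr.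
  - exact: measurable_deviation Ttau.
  - by move=> g; exact: powR_ge0.
  - move=> g; rewrite powE mulrA -[leRHS]mul1r ler_wpM2r ?powR_ge0//.
    rewrite -[leRHS](@mulfV _ rho) ?gt_eqF// ler_wpM2l ?(ltW rho0)// -eE.
    by apply: ge0_ler_powR; rewrite ?nnegrE ?normc_ge0 ?expR_ge0// ltW.
  - move=> g Gg; rewrite powE mulrA ler_wpM2r ?powR_ge0//.
    rewrite -ler_pdivlMl// mulrC.
    apply: le_trans KE.
    by apply: ge0_ler_powR; rewrite ?nnegrE ?normc_ge0 ?expR_ge0 ?s2// ltW.
rewrite leeD2l//.
have mAG : measurable (A `\` G) by exact: measurableD.
move: AGz; rewrite -(fineK (fin_num_measure mu0 _ mAG)).
by rewrite -EFinM lte_fin lee_fin ltr_pdivlMr// mulrC => /ltW.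
Qed.

(** A near-optimal tau for mu0 is a competitor for nu, with a bounded
    integrand. *)
Lemma dist_p_upper (m : nat) (p e : R) mu0 : 0 < p -> 0 < e ->
  exists2 t : R, 0 < t & forall nu : {finite_measure set (circle R) -> \bar R},
    (total_variation_norm (measure_diff mu0 nu) < t%:E)%E ->
    (dist_p p nu (ints_from m) <= dist_p p mu0 (ints_from m) + e%:E)%E.
Proof.
move=> p0 e0; have e20 : 0 < e / 2 by rewrite divr_gt0.
have [_ [tau Ttau <-] tauE] : exists2 x,
    [set (\int[mu0]_g (normc (1 - tau g) `^ p)%:E)%E
      | tau in trig_poly (ints_from m)] x &
    (x < dist_p p mu0 (ints_from m) + (e / 2)%:E)%E.
  apply: lb_ereal_inf_adherent => //; exact: dist_p_fin.
have [C C0 hC] := deviation_bounded p0 Ttau.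
exists (e / 2 / C); first by rewrite divr_gt0.
move=> nu TV.
apply: (@le_trans _ _ (\int[nu]_g (normc (1 - tau g) `^ p)%:E)%E).
  by apply: ereal_inf_lbound; exists tau.
apply: (le_trans
  (integral_le_total_variation mu0 nu (measurable_deviation p Ttau) hC)).
rewrite [e in leRHS]splitr EFinD addeA; apply: leeD; first exact: ltW.
move: TV; case: (total_variation_norm _) => [r| |]//=; last first.
  by move=> _; rewrite gt0_muleNy ?lte_fin// leNye.
by rewrite -EFinM lte_fin lee_fin ltr_pdivlMr// mulrC => /ltW.
Qed.

End distance.

Theorem corollary5p7 (R : realType)
    (mu0 : {finite_measure set (circle R) -> \bar R})
    (mu : nat -> {finite_measure set (circle R) -> \bar R})
    (mu0_nonzero : nonzero_measure mu0)
    (mu_nonzero : forall n, nonzero_measure (mu n))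
    (mu0_ac : mu0 `<< @circle_lebesgue R)
    (mu_ac : forall n, mu n `<< @circle_lebesgue R)
    (mu_cvg : total_variation_norm (measure_diff mu0 (mu n)) @[n --> \oo]
              --> 0%E)
    (mu_ge : exists c : R, 0 < c /\
       forall (n : nat) (A : set (circle R)), measurable A ->
         (c%:E * mu0 A <= mu n A)%E) :
  forall (m : nat) (p : R), (0 < m)%N -> 0 < p ->
    dist_p p (mu n) (ints_from m) @[n --> \oo]
    --> dist_p p mu0 (ints_from m).
Proof.
move=> m p _ p0; have [c [c0 cmp]] := mu_ge.
have TV t : 0 < t -> \forall n \near \oo,
    (total_variation_norm (measure_diff mu0 (mu n)) < t%:E)%E.
  move=> t0; have /fine_cvgP[TVfin /cvgrPdist_lt/(_ t t0)] := mu_cvg.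
  apply: filterS2 TVfin => n TVfin /=; rewrite sub0r normrN => TVt.
  by rewrite -(fineK TVfin) lte_fin (le_lt_trans (ler_norm _)).
set D := fun nu : {finite_measure set (circle R) -> \bar R} =>
  fine (dist_p p nu (ints_from m)).
have DE nu : dist_p p nu (ints_from m) = (D nu)%:E.
  by rewrite /D fineK// dist_p_fin.
rewrite DE; under eq_fun do rewrite DE.
apply: cvg_EFin; first by apply: nearW.
apply/cvgrPdist_le => e e0.
have D0 : 0 <= D mu0 by rewrite /D fine_ge0// dist_p_ge0.
have [t1 t10 H1] := dist_p_upper m mu0 p0 e0.
(* Chosen so that 2 (1 - rho) D mu0 <= e, with rho > 0 even if D mu0 is 0. *)
pose rho := 1 - e / (2 * (D mu0 + e)).
have De : 0 < 2 * (D mu0 + e) by lra.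
have rho01 : 0 < rho < 1.
  rewrite /rho; apply/andP; split; last by rewrite ltrBlDr ltrDl divr_gt0.
  by rewrite subr_gt0 ltr_pdivrMr//; lra.
have rhoD : D mu0 - e <= rho ^+ 2 * D mu0.
  have : (1 - rho) * (2 * (D mu0 + e)) = e.
    by rewrite /rho opprB addrC subrK mulfVK// gt_eqF.
  have /andP[_ rho1] := rho01.
  have : 0 <= (1 - rho) * e by rewrite mulr_ge0 ?subr_ge0// ltW.
  have : 0 <= (1 - rho) ^+ 2 * D mu0 by rewrite mulr_ge0 ?sqr_ge0.
  rewrite expr2; nra.
have [t2 t20 H2] := dist_p_lower m p0 c0 rho01 mu0_ac.
near=> n.
have h1 : (total_variation_norm (measure_diff mu0 (mu n)) < t1%:E)%E.
  by near: n; exact: TV.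
have h2 : (total_variation_norm (measure_diff mu0 (mu n)) < t2%:E)%E.
  by near: n; exact: TV.
have := H1 _ h1; have := H2 _ (cmp n) h2.
rewrite !DE -EFinM -EFinD !lee_fin => l1 l2.
rewrite /= ler_distl; apply/andP; split; lra.
Unshelve. all: by end_near.
Qed.
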